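(* Let $A=\mathrm{diag}\{\lambda_1,\dots,\lambda_n\}$ with $0<\lambda_1<\lambda_2<\cdots<\lambda_n$, $\kappa=\lambda_n/\lambda_1$, let $b\in\mathbb{R}^n$, and let $f(x)=\frac12 x^{\top}Ax-b^{\top}x$. Let $x_0\in\mathbb{R}^n$ and let $\{x_k\}$ be generated by the gradient method $x_{k+1}=x_k-\alpha_k g_k$, where $g_k=\nabla f(x_k)=Ax_k-b$, with stepsizes satisfying $\lambda_1\leqslant\alpha_k^{-1}\leqslant\lambda_n$ for all $k\geqslant 0$. Let $\tilde\theta=1-1/\kappa$ and $\tilde\sigma_i=\max\left\{\frac{\lambda_i}{\lambda_1}-1,\ 1-\frac{\lambda_i}{\lambda_n}\right\}$. (i) Suppose Property B (defined in the context) is satisfied with $v(k)=k-r$ for some integer $r\in[1,m-1]$ and all $k\geqslant r$. Then either $g_k=0$ for some finite $k$, or $\{\|g_k\|\}$ converges to zero $R$-linearly in the sense that, for all $k\geqslant 0$, $$|g_k^{(i)}|\leqslant\widetilde C_i\,\tilde\theta^k,\qquad i=1,2,\dots,n,$$ where $\widetilde C_1=|g_0^{(1)}|$ and, for $i=2,3,\dots,n$, $$\widetilde C_i=\max\left\{|g_0^{(i)}|,\ \frac{|g_1^{(i)}|}{\tilde\theta},\ \dots,\ \frac{|g_r^{(i)}|}{\tilde\theta^r},\ \frac{\tilde\sigma_i^{r+1}}{\tilde\theta^{r+1}\psi(\lambda_i)}\sqrt{\sum_{j=1}^{i-1}\psi^2(\lambda_j)\,\widetilde C_j^2}\right\}.$$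 (ii) Suppose Property B is satisfied with $v(k)$ in its condition (ii) replaced by $v_i(k)\in\{k,k-1,\dots,\max\{k-m_i+1,0\}\}$ for all $i=1,\dots,s$, where $m_1,\dots,m_s$ and $s$ are positive integers. Then either $g_k=0$ for some finite $k$, or $\{\|g_k\|\}$ converges to zero $R$-linearly in the sense that, for all $k\geqslant 0$, $|g_k^{(i)}|\leqslant\widetilde C_i\,\tilde\theta^k$ for $i=1,\dots,n$, where $m=\max\{m_1,\dots,m_s\}$, $\widetilde C_1=|g_0^{(1)}|$ and, for $i=2,3,\dots,n$, $$\widetilde C_i=\max\left\{|g_0^{(i)}|,\ \frac{|g_1^{(i)}|}{\tilde\theta},\ \dots,\ \frac{|g_{m-1}^{(i)}|}{\tilde\theta^{m-1}},\ \frac{\max\{\tilde\sigma_i,\tilde\sigma_i^m\}}{\tilde\theta^m\psi(\lambda_i)}\sqrt{\sum_{j=1}^{i-1}\psi^2(\lambda_j)\,\widetilde C_j^2}\right\}.$$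
   Context: $g_k^{(i)}$ denotes the $i$-th component of $g_k\in\mathbb{R}^n$, and $\psi^2(A)=\psi(A)^2$, where $\psi(A)=\mathrm{diag}\{\psi(\lambda_1),\dots,\psi(\lambda_n)\}$. Property B: the stepsizes $\alpha_k$ have Property B if there exist a positive integer $m$ and a positive constant $M_1\geqslant\lambda_1$ such that, for every $k\geqslant 0$ (the iteration being stopped if $g_k=0$): (i) $\lambda_1\leqslant\alpha_k^{-1}\leqslant M_1$; (ii) for some integer $v(k)\in\{k,k-1,\dots,\max\{k-m+1,0\}\}$, $$\alpha_k\leqslant\frac{g_{v(k)}^{\top}\psi^2(A)g_{v(k)}}{g_{v(k)}^{\top}A\psi^2(A)g_{v(k)}},$$ where $\psi$ (not depending on $k$) is a real analytic function on $[\lambda_1,\lambda_n]$ that can be expressed by a Laurent series $\psi(z)=\sum_{p=-\infty}^{\infty}d_p z^p$, $d_p\in\mathbb{R}$, with $0<\sum_{p=-\infty}^{\infty}d_p z^p<+\infty$ for all $z\in[\lambda_1,\lambda_n]$. Here condition (i) holds with $M_1=\lambda_n$ by assumption. ''Property B is satisfied with $v(k)=k-r$ for all $k\geqslant r$'' means: condition (i) holds for all $k\geqslant0$ and the inequality in (ii) holds with $v(k)=k-r$ for all $k\geqslant r$ (nothing is required in (ii) for $k<r$). ''Property B is satisfied with $v(k)$ replaced by $v_i(k)$ for all $i=1,\dots,s$'' means: condition (i) holds for all $k\geqslant 0$ and, for every $k\geqslant 0$ and every $i=1,\dots,s$, the inequality in (ii) holds with $v(k)$ replaced by an integer $v_i(k)\in\{k,k-1,\dots,\max\{k-m_i+1,0\}\}$.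 *)

(* Defs.v *)
From HB Require Import structures.
From mathcomp Require Import all_boot all_order all_algebra.
From mathcomp Require Import all_classical all_reals all_analysis ring.
Set Implicit Arguments.
Unset Strict Implicit.
Unset Printing Implicit Defensive.
Import Order.TTheory GRing.Theory Num.Theory.
Import numFieldNormedType.Exports.
Local Open Scope classical_set_scope.
Local Open Scope ring_scope.

Definition quadratic (R : realType) (n : nat) (A : 'M[R]_n) (b x : 'cV[R]_n) : R :=
  2^-1 * (x^T *m A *m x) 0 0 - (b^T *m x) 0 0.

Definition gradient (R : realType) (n : nat) (f : 'cV[R]_n -> R) (x : 'cV[R]_n) :
  'cV[R]_n := \col_i 'D_(delta_mx i 0) f x.

Lemma gradient_quadratic (R : realType) (n : nat) (A : 'M[R]_n) (b x : 'cV[R]_n) :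
  A^T = A -> gradient (quadratic A b) x = A *m x - b.
Proof.
move=> symA; apply/colP => i; rewrite /gradient mxE.
set v : 'cV[R]_n := delta_mx i 0.
have trE (u w : 'cV[R]_n) : (u^T *m w) 0 0 = (w^T *m u) 0 0.
  by rewrite !mxE; apply: eq_bigr => k _; rewrite !mxE mulrC.
have vE (w : 'cV[R]_n) : (v^T *m w) 0 0 = w i 0.
  by rewrite /v trmx_delta -rowE mxE.
have xAv : (x^T *m A *m v) 0 0 = (A *m x) i 0.
  by rewrite -mulmxA trE trmx_mul symA -mulmxA vE.
have vAx : (v^T *m A *m x) 0 0 = (A *m x) i 0 by rewrite -mulmxA vE.
set q := (v^T *m A *m v) 0 0.
have E h : quadratic A b (h *: v + x) - quadratic A b x =
    h * ((A *m x - b) i 0 + h * (2^-1 * q)).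
  rewrite /quadratic; have -> : (h *: v + x)^T = h *: v^T + x^T by rewrite linearD linearZ.
  rewrite !mulmxDl !mulmxDr -!scalemxAl -!scalemxAr.
  have bv : (b^T *m v) 0 0 = b i 0 by rewrite trE vE.
  move: xAv vAx bv; rewrite /q !mxE => -> -> ->.
  set t := \sum_(_ < n) _; set a := \sum_(_ < n) _; set c := \sum_(_ < n) _.
  set d := \sum_(_ < n) _.
  have h2 : (2 : R) != 0 by rewrite pnatr_eq0.
  by field.
rewrite /derive; apply/cvg_lim => //=.
apply: (@cvg_trans _
  ((fun h : R => (A *m x - b) i 0 + h * (2^-1 * q)) @ 0^')).
  apply: near_eq_cvg; near=> h.
  have h0 : h != 0 by near: h; exact: nbhs_dnbhs_neq.
  by rewrite E; exact/esym/mulKf.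
set c := (A *m x - b) i 0.
suff : (fun h : R => c + h * (2^-1 * q)) @ 0^' --> c + 0 * (2^-1 * q).
  by rewrite mul0r addr0.
apply: cvgD; first exact: cvg_cst.
by apply: cvgM; [exact: cvg_within | exact: cvg_cst].
Unshelve. all: by end_near.
Qed.

Definition eucl_norm (R : realType) (n : nat) (v : 'cV[R]_n) : R :=
  Num.sqrt (\sum_i v i 0 ^+ 2).

(* The power series is only compared with [f] on [a, b]; when a < b this still
   forces a positive radius of convergence at the end points, so that [f]
   extends analytically to a neighbourhood of [a, b]. *)
Definition real_analytic_on (R : realType) (a b : R) (f : R -> R) : Prop :=
  forall z0, a <= z0 <= b -> exists (c : nat -> R) (e : R), 0 < e /\
    forall z, a <= z <= b -> `|z - z0| < e ->
      series (fun p => c p * (z - z0) ^+ p) @ \oo --> f z.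

(* Two-sided summation: the parts p >= 0 and p < 0 converge separately;
   [Negz p] is the integer -(p + 1). *)
Definition laurent_sum (R : realType) (d : int -> R) (z l : R) : Prop :=
  exists l1 l2 : R, [/\
    series (fun p : nat => d (Posz p) * z ^ Posz p) @ \oo --> l1,
    series (fun p : nat => d (Negz p) * z ^ Negz p) @ \oo --> l2 &
    l = l1 + l2].

Definition laurent_admissible (R : realType) (a b : R) (psi : R -> R) : Prop :=
  real_analytic_on a b psi /\
  exists d : int -> R, forall z, a <= z <= b ->
    laurent_sum d z (psi z) /\ 0 < psi z.

(* In what follows vectors have size n.+1 and the eigenvalues
   lambda_1, ..., lambda_{n+1} are [lam 0 ord0], ..., [lam 0 ord_max]. *)

Definition diag_fun (R : realType) (n : nat) (psi : R -> R) (lam : 'rV[R]_n.+1) :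
  'M[R]_n.+1 := diag_mx (map_mx psi lam).

Definition psi_quotient (R : realType) (n : nat) (lam : 'rV[R]_n.+1)
    (psi : R -> R) (v : 'cV[R]_n.+1) : R :=
  (v^T *m diag_fun psi lam ^+ 2 *m v) 0 0 /
  (v^T *m (diag_mx lam *m diag_fun psi lam ^+ 2) *m v) 0 0.

(* The requirements on the stepsizes below are imposed only while [g k != 0]:
   the iteration stops as soon as the gradient vanishes. *)

Definition stepsize_bounds (R : realType) (n : nat) (lam : 'rV[R]_n.+1)
    (g : nat -> 'cV[R]_n.+1) (alpha : nat -> R) (M1 : R) : Prop :=
  forall k, g k != 0 -> lam 0 ord0 <= (alpha k)^-1 <= M1.

Definition propertyB_lag (R : realType) (n : nat) (lam : 'rV[R]_n.+1)
    (g : nat -> 'cV[R]_n.+1) (alpha : nat -> R) (psi : R -> R) (r : nat) : Prop :=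
  [/\ stepsize_bounds lam g alpha (lam 0 ord_max),
      laurent_admissible (lam 0 ord0) (lam 0 ord_max) psi &
      forall k, (r <= k)%N -> g k != 0 ->
        alpha k <= psi_quotient lam psi (g (k - r)%N)].

(* Truncated subtraction makes [k.+1 - m_ i] equal to max{k - m_i + 1, 0}. *)
Definition propertyB_multi (R : realType) (n : nat) (lam : 'rV[R]_n.+1)
    (g : nat -> 'cV[R]_n.+1) (alpha : nat -> R) (psi : R -> R)
    (s : nat) (m_ : 'I_s -> nat) : Prop :=
  [/\ stepsize_bounds lam g alpha (lam 0 ord_max),
      laurent_admissible (lam 0 ord0) (lam 0 ord_max) psi &
      forall k, g k != 0 -> forall i : 'I_s, exists v : nat,
        (k.+1 - m_ i <= v <= k)%N /\ alpha k <= psi_quotient lam psi (g v)].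

Definition cond_number (R : realType) (n : nat) (lam : 'rV[R]_n.+1) : R :=
  lam 0 ord_max / lam 0 ord0.

Definition theta (R : realType) (n : nat) (lam : 'rV[R]_n.+1) : R :=
  1 - (cond_number lam)^-1.

Definition sigma (R : realType) (n : nat) (lam : 'rV[R]_n.+1) (i : 'I_n.+1) : R :=
  Num.max (lam 0 i / lam 0 ord0 - 1) (1 - lam 0 i / lam 0 ord_max).

(* Recursion determining the constants C_i, with [N] initial gradients and
   [tau i] standing for the numerator in front of the square root. *)
Definition rate_constants (R : realType) (n : nat) (lam : 'rV[R]_n.+1)
    (g : nat -> 'cV[R]_n.+1) (psi : R -> R) (N : nat) (tau : 'I_n.+1 -> R)
    (C : 'I_n.+1 -> R) : Prop :=
  C ord0 = `|g 0%N ord0 0| /\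
  forall i : 'I_n.+1, i != ord0 ->
    C i = Num.max
      (\big[Num.max/`|g 0%N i 0|]_(1 <= j < N) (`|g j i 0| / theta lam ^+ j))
      (tau i / (theta lam ^+ N * psi (lam 0 i)) *
       Num.sqrt (\sum_(j < n.+1 | (j < i)%N) psi (lam 0 j) ^+ 2 * C j ^+ 2)).

Definition R_linear_with (R : realType) (n : nat) (lam : 'rV[R]_n.+1)
    (g : nat -> 'cV[R]_n.+1) (C : 'I_n.+1 -> R) : Prop :=
  ((fun k => eucl_norm (g k)) @ \oo --> (0 : R)) /\
  forall (k : nat) (i : 'I_n.+1), `|g k i 0| <= C i * theta lam ^+ k.

(* Main.v *)
(* The gradient components evolve independently, the i-th one being multiplied
   by [1 - alpha k * lam i].  Any factor with [alpha k * lam i <= 1] is at most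
   theta in absolute value.  When [alpha k * lam i > 1], rewrite the stepsize
   condition as [0 <= \sum_j (1 - alpha k * lam j) * (psi (lam j) * g_v j)^2]:
   the terms with j > i are negative and those with j < i have
   coefficient at most theta, so either the factor is still at most theta or
   the i-th component of g_v is dominated by the components j < i, for which
   the geometric decay is already known. *)
Require Import Defs.
From HB Require Import structures.
From mathcomp Require Import all_boot all_order all_algebra.
From mathcomp Require Import all_classical all_reals all_analysis.
From mathcomp Require Import ring lra zify.
Set Implicit Arguments.
Unset Strict Implicit.
Unset Printing Implicit Defensive.
Import Order.TTheory GRing.Theory Num.Theory.
Import numFieldNormedType.Exports.
Local Open Scope ring_scope.

(** * Eigenvalues, contraction factors and their bounds *)

Lemma eigenvalue_bounds (R : realType) (n : nat) (lam : 'rV[R]_n.+1)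
    (lam_incr : forall i j : 'I_n.+1, (i < j)%N -> lam 0 i < lam 0 j)
    (i : 'I_n.+1) : lam 0 ord0 <= lam 0 i <= lam 0 ord_max.
Proof.
have le_lam (j k : 'I_n.+1) : (j <= k)%N -> lam 0 j <= lam 0 k.
  rewrite leq_eqVlt => /orP[/eqP/val_inj->//|/lam_incr/ltW//].
by rewrite !le_lam // -ltnS.
Qed.

Lemma theta_itv (R : realType) (n : nat) (lam : 'rV[R]_n.+1)
    (lam_gt0 : 0 < lam 0 ord0)
    (lam_incr : forall i j : 'I_n.+1, (i < j)%N -> lam 0 i < lam 0 j) :
  (0 < n)%N -> 0 < theta lam < 1.
Proof.
move=> n_gt0; rewrite /theta /cond_number invf_div.
have lt_lam : lam 0 ord0 < lam 0 ord_max by exact: lam_incr.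
have max_gt0 := lt_trans lam_gt0 lt_lam.
by rewrite subr_gt0 ltr_pdivrMr // mul1r lt_lam gtrBl divr_gt0.
Qed.

Lemma sigma_ge0 (R : realType) (n : nat) (lam : 'rV[R]_n.+1)
    (lam_gt0 : 0 < lam 0 ord0)
    (lam_incr : forall i j : 'I_n.+1, (i < j)%N -> lam 0 i < lam 0 j)
    (i : 'I_n.+1) : 0 <= sigma lam i.
Proof.
have /andP[lami _] := eigenvalue_bounds lam_incr i.
by rewrite le_max subr_ge0 ler_pdivlMr // mul1r lami.
Qed.

Lemma factor_itv (R : realType) (n : nat) (lam : 'rV[R]_n.+1)
    (lam_gt0 : 0 < lam 0 ord0)
    (lam_incr : forall i j : 'I_n.+1, (i < j)%N -> lam 0 i < lam 0 j)
    (a : R) (i : 'I_n.+1) : lam 0 ord0 <= a^-1 <= lam 0 ord_max ->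
  lam 0 i / lam 0 ord_max <= a * lam 0 i <= lam 0 i / lam 0 ord0.
Proof.
move=> /andP[a_ge a_le].
have /andP[lami lamx] := eigenvalue_bounds lam_incr i.
have lami_gt0 := lt_le_trans lam_gt0 lami.
have lamx_gt0 := lt_le_trans lami_gt0 lamx.
have av_gt0 : 0 < a^-1 by exact: lt_le_trans a_ge.
rewrite ![lam 0 i / _]mulrC !ler_pM2r // -[a]invrK.
by rewrite !lef_pV2 ?posrE ?a_le.
Qed.

(** The two entries of the maximum in [sigma] cover the two possible signs of [1 - a * lam 0 i]. *)
Lemma factor_le_sigma (R : realType) (n : nat) (lam : 'rV[R]_n.+1)
    (lam_gt0 : 0 < lam 0 ord0)
    (lam_incr : forall i j : 'I_n.+1, (i < j)%N -> lam 0 i < lam 0 j)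
    (a : R) (i : 'I_n.+1) : lam 0 ord0 <= a^-1 <= lam 0 ord_max ->
  `|1 - a * lam 0 i| <= sigma lam i.
Proof.
move=> /(factor_itv lam_gt0 lam_incr i)/andP[lo hi].
rewrite /sigma le_max ler_norml ler_norml.
by have [le1|gt1] := leP (a * lam 0 i) 1; apply/orP; [right|left];
  apply/andP; split; lra.
Qed.

(** One-sided on purpose: [a * lam 0 i] is at least the inverse condition number, but above it is
    bounded only by [lam 0 i / lam 0 ord0], so the absolute value may exceed [theta]. *)
Lemma factor_le_theta (R : realType) (n : nat) (lam : 'rV[R]_n.+1)
    (lam_gt0 : 0 < lam 0 ord0)
    (lam_incr : forall i j : 'I_n.+1, (i < j)%N -> lam 0 i < lam 0 j)
    (a : R) (i : 'I_n.+1) : lam 0 ord0 <= a^-1 <= lam 0 ord_max ->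
  1 - a * lam 0 i <= theta lam.
Proof.
move=> /(factor_itv lam_gt0 lam_incr i)/andP[lo _].
have /andP[lami lamx] := eigenvalue_bounds lam_incr i.
rewrite /theta /cond_number invf_div lerB //; apply: le_trans lo.
by rewrite ler_pM2r // invr_gt0 (lt_le_trans lam_gt0) // (le_trans lami).
Qed.

(** * The stepsize condition in coordinates *)

Lemma quad_diag_mx (R : realType) (n : nat) (d : 'rV[R]_n) (v : 'cV[R]_n) :
  (v^T *m diag_mx d *m v) 0 0 = \sum_j d 0 j * v j 0 ^+ 2.
Proof.
rewrite mul_mx_diag mxE; apply: eq_bigr => j _.
by rewrite !mxE; ring.
Qed.

Lemma psi_quotientE (R : realType) (n : nat) (lam : 'rV[R]_n.+1)
    (psi : R -> R) (v : 'cV[R]_n.+1) :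
  psi_quotient lam psi v =
  (\sum_j psi (lam 0 j) ^+ 2 * v j 0 ^+ 2) /
  (\sum_j lam 0 j * (psi (lam 0 j) ^+ 2 * v j 0 ^+ 2)).
Proof.
rewrite /psi_quotient /diag_fun expr2 -mulmxE !mulmx_diag !quad_diag_mx.
by congr (_ / _); apply: eq_bigr => j _; rewrite !mxE; ring.
Qed.

(** Clearing the denominator of the quotient is legitimate because some component of [v] is nonzero
    and all weights are positive. *)
Lemma stepsize_le_quotient (R : realType) (n : nat) (lam : 'rV[R]_n.+1)
    (psi : R -> R) (v : 'cV[R]_n.+1) (a : R) :
  (forall j, 0 < lam 0 j) -> (forall j, 0 < psi (lam 0 j)) -> v != 0 ->
  a <= psi_quotient lam psi v ->
  0 <= \sum_j (1 - a * lam 0 j) * (psi (lam 0 j) ^+ 2 * v j 0 ^+ 2).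
Proof.
move=> lam_gt0 psi_gt0 v_neq0; rewrite psi_quotientE ler_pdivlMr.
  rewrite mulr_sumr -subr_ge0 -sumrB => /le_trans; apply.
  by apply: ler_sum => j _; rewrite le_eqVlt; apply/orP; left; apply/eqP; ring.
have w_ge0 j : 0 <= lam 0 j * (psi (lam 0 j) ^+ 2 * v j 0 ^+ 2).
  rewrite mulr_ge0 ?(ltW (lam_gt0 _)) //.
  by rewrite mulr_ge0 ?sqr_ge0.
have [j vj] : exists j, v j 0 != 0.
  by apply/existsP; apply: contraNT v_neq0 => /existsPn v0;
    apply/eqP/colP => j; rewrite mxE; apply/eqP/negPn.
rewrite lt_neqAle sumr_ge0 // andbT eq_sym psumr_neq0 //.
apply/hasP; exists j; first by rewrite mem_index_enum.
by rewrite /= mulr_gt0 // mulr_gt0 // exprn_even_gt0 // lt0r_neq0.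
Qed.

Lemma factor_le_theta_or_dominated (R : realType) (n : nat) (lam : 'rV[R]_n.+1)
    (lam_gt0 : 0 < lam 0 ord0)
    (lam_incr : forall i j : 'I_n.+1, (i < j)%N -> lam 0 i < lam 0 j)
    (psi : R -> R) (v : 'cV[R]_n.+1) (a : R) (i : 'I_n.+1) :
  (forall j, 0 < psi (lam 0 j)) -> v != 0 ->
  lam 0 ord0 <= a^-1 <= lam 0 ord_max -> a <= psi_quotient lam psi v ->
  `|1 - a * lam 0 i| <= theta lam \/
  psi (lam 0 i) ^+ 2 * v i 0 ^+ 2 <=
  \sum_(j < n.+1 | (j < i)%N) psi (lam 0 j) ^+ 2 * v j 0 ^+ 2.
Proof.
move=> psi_gt0 v_neq0 aB a_le.
have lam_pos j : 0 < lam 0 j.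
  by case/andP: (eigenvalue_bounds lam_incr j) => + _; exact: lt_le_trans.
have le_theta := factor_le_theta lam_gt0 lam_incr _ aB.
have a_gt0 : 0 < a.
  by rewrite -invr_gt0 (lt_le_trans lam_gt0) //; case/andP: aB.
have [le1|gt1] := leP (a * lam 0 i) 1.
  by left; rewrite ger0_norm ?subr_ge0.
set w := fun j => psi (lam 0 j) ^+ 2 * v j 0 ^+ 2.
have w_ge0 j : 0 <= w j by rewrite mulr_ge0 ?sqr_ge0.
set G := \sum_(j < n.+1 | (j < i)%N) w j.
have [|lt_G] := leP (w i) G; [by right|left].
have G_ge0 : 0 <= G by exact: sumr_ge0.
rewrite ler0_norm ?subr_le0 ?(ltW gt1)// opprB.
have key : (a * lam 0 i - 1) * w i <= theta lam * G.
  have := stepsize_le_quotient lam_pos psi_gt0 v_neq0 a_le.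
  rewrite (bigID (fun j : 'I__ => (j < i)%N)) /=.
  rewrite [X in _ + X](bigD1 i) ?ltnn //= -/(w i).
  set S1 := \sum_(_ < _ | _) _; set S2 := \sum_(_ < _ | _) _.
  have S1_le : S1 <= theta lam * G.
    by rewrite mulr_sumr; apply: ler_sum => j _;
      exact: (ler_wpM2r (w_ge0 j) (le_theta j)).
  have S2_le : S2 <= 0.
    apply: sumr_le0 => j /andP[]; rewrite -leqNgt => ij neq_ji.
    rewrite mulr_le0_ge0 ?w_ge0 // subr_le0 (le_trans (ltW gt1)) //.
    rewrite ler_pM2l // ltW // lam_incr // ltn_neqAle ij andbT.
    by rewrite eq_sym.
  by lra.
(* If the factor exceeded [theta], then [G < w i] and [0 <= G] would make the left side of [key]
   strictly larger than its right side; strictness comes from [G < w i], so [G = 0] is covered. *)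
rewrite leNgt; apply/negP => lt_d.
have d_gt0 : 0 < a * lam 0 i - 1 by rewrite subr_gt0.
have h1 : (a * lam 0 i - 1) * G < (a * lam 0 i - 1) * w i by rewrite ltr_pM2l.
have h2 : theta lam * G <= (a * lam 0 i - 1) * G by rewrite ler_wpM2r // ltW.
by have := lt_le_trans h1 (le_trans key h2); rewrite ltxx.
Qed.

(** * Gradient recursion, constants and componentwise decay *)

Lemma gradient_step (R : realType) (n : nat) (lam : 'rV[R]_n)
    (b : 'cV[R]_n) (x : nat -> 'cV[R]_n) (alpha : nat -> R)
    (g : nat -> 'cV[R]_n)
    (gE : forall k, g k = gradient (quadratic (diag_mx lam) b) (x k))
    (xS : forall k, x k.+1 = x k - alpha k *: g k) (k : nat) (i : 'I_n) :
  g k.+1 i 0 = (1 - alpha k * lam 0 i) * g k i 0.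
Proof.
have {}gE l : g l = diag_mx lam *m x l - b.
  by rewrite gE gradient_quadratic // tr_diag_mx.
have -> : g k.+1 = g k - alpha k *: (diag_mx lam *m g k).
  by rewrite [LHS]gE xS mulmxBr -scalemxAr addrAC -gE.
by rewrite mul_diag_mx !mxE; ring.
Qed.

(** The recursion for [C i] only refers to smaller indices, so after [k] iterations of [F] from zero
    the entries below [k] no longer change; [n.+1] iterations give a fixed point. *)
Lemma rate_constants_exist (R : realType) (n : nat) (lam : 'rV[R]_n.+1)
    (g : nat -> 'cV[R]_n.+1) (psi : R -> R) (N : nat) (tau : 'I_n.+1 -> R) :
  exists C, rate_constants lam g psi N tau C.
Proof.
pose F (C : 'I_n.+1 -> R) (i : 'I_n.+1) : R := if i == ord0 then `|g 0%N ord0 0| else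
  Num.max
      (\big[Num.max/`|g 0%N i 0|]_(1 <= j < N) (`|g j i 0| / theta lam ^+ j))
      (tau i / (theta lam ^+ N * psi (lam 0 i)) *
       Num.sqrt (\sum_(j < n.+1 | (j < i)%N) psi (lam 0 j) ^+ 2 * C j ^+ 2)).
have F_local C D (i : 'I_n.+1) : (forall j : 'I_n.+1, (j < i)%N -> C j = D j) ->
    F C i = F D i.
  move=> eqCD; rewrite /F; case: eqP => // _.
  by congr (Num.max _ (_ * Num.sqrt _)); apply: eq_bigr => j /eqCD->.
have stable k : forall i : 'I_n.+1, (i < k)%N ->
    iter k.+1 F (fun=> 0) i = iter k F (fun=> 0) i.
  elim: k => // k IHk i ik; apply: F_local => j ji.
  exact/IHk/(leq_trans ji).
exists (iter n.+1 F (fun=> 0)); split.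
  by rewrite iterS /F eqxx.
move=> i i_neq0; rewrite -[LHS]stable ?ltn_ord // iterS {1}/F.
by rewrite (negPf i_neq0).
Qed.

(** Common core of both cases: [N] is the length of the window containing [v], and [tau i] bounds
    the growth of component [i] from time [v] to time [k.+1]. The induction is on the component
    first, then on time. *)
Lemma component_decay (R : realType) (n : nat) (lam : 'rV[R]_n.+1)
    (b : 'cV[R]_n.+1) (x : nat -> 'cV[R]_n.+1) (alpha : nat -> R)
    (g : nat -> 'cV[R]_n.+1)
    (lam_gt0 : 0 < lam 0 ord0)
    (lam_incr : forall i j : 'I_n.+1, (i < j)%N -> lam 0 i < lam 0 j)
    (gE : forall k, g k = gradient (quadratic (diag_mx lam) b) (x k))
    (xS : forall k, x k.+1 = x k - alpha k *: g k)
    (alpha_bounds : stepsize_bounds lam g alpha (lam 0 ord_max))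
    (psi : R -> R) (N : nat) (tau C : 'I_n.+1 -> R) :
  0 < theta lam < 1 -> (forall k, g k != 0) -> (0 < N)%N ->
  (forall j, 0 < psi (lam 0 j)) ->
  (forall k i, (N <= k.+1)%N -> exists v : nat,
    [/\ (k.+1 - N <= v <= k)%N, alpha k <= psi_quotient lam psi (g v) &
        sigma lam i ^+ (k.+1 - v) <= tau i]) ->
  rate_constants lam g psi N tau C ->
  forall (i : 'I_n.+1) (k : nat), `|g k i 0| <= C i * theta lam ^+ k.
Proof.
move=> /andP[th_gt0 th_lt1] g_neq0 N_gt0 psi_gt0 window [C0 CS].
have step := gradient_step gE xS.
have aB k : lam 0 ord0 <= (alpha k)^-1 <= lam 0 ord_max by exact: alpha_bounds.
have contract i k : `|1 - alpha k * lam 0 i| <= theta lam ->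
    `|g k i 0| <= C i * theta lam ^+ k -> `|g k.+1 i 0| <= C i * theta lam ^+ k.+1.
  by move=> le_th IH; rewrite step normrM exprS mulrCA ler_pM.
have growth i v d : `|g (v + d)%N i 0| <= sigma lam i ^+ d * `|g v i 0|.
  elim: d => [|d IHd]; first by rewrite addn0 expr0 mul1r.
  rewrite addnS step normrM exprS -mulrA ler_pM //.
  exact: (factor_le_sigma lam_gt0 lam_incr i (aB _)).
move=> i; have [p] := ubnP (val i); elim: p i => // p IHp i; rewrite ltnS => le_ip.
(* For the smallest eigenvalue [alpha k * lam 0 ord0 <= 1], so every step contracts by [theta]. *)
have [->|i_neq0] := eqVneq i ord0.
  elim=> [|k IHk]; first by rewrite C0 expr0 mulr1.
  apply: contract => //; rewrite ger0_norm;
    first exact: (factor_le_theta lam_gt0 lam_incr _ (aB k)).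
  have /andP[_] := factor_itv lam_gt0 lam_incr ord0 (aB k).
  by rewrite divff ?gt_eqF // subr_ge0.
have Ci := CS i i_neq0; set S := \sum_(_ < _ | _) _ in Ci.
have init k : (k < N)%N -> `|g k i 0| <= C i * theta lam ^+ k.
  move=> kN; rewrite -ler_pdivrMr ?exprn_gt0 // Ci le_max; apply/orP; left.
  (* Time 0 is the default value of the iterated maximum, whose range starts at 1. *)
  case: k kN => [|k] kN.
    by rewrite expr0 divr1; exact: bigmax_ge_id.
  apply: (@le_bigmax_seq _ _ _ _ _ k.+1 xpredT
    (fun j => `|g j i 0| / theta lam ^+ j)) => //.
  by rewrite mem_index_iota.
elim=> [|k IHk]; first exact: init.
have [/init//|leNk] := ltnP k.+1 N.
have [v [/andP[v_ge v_le] a_le tau_ge]] := window k i leNk.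
have [/contract/(_ IHk)//|dom] :=
  factor_le_theta_or_dominated lam_gt0 lam_incr i psi_gt0 (g_neq0 v) (aB k) a_le.
have S_ge0 : 0 <= S by apply: sumr_ge0 => j _; rewrite mulr_ge0 ?sqr_ge0.
(* Squaring reduces this to [dom], with the outer induction hypothesis applied at time [v] to each
   [j < i]. *)
have gv_le : psi (lam 0 i) * `|g v i 0| <= theta lam ^+ v * Num.sqrt S.
  rewrite -(@ler_pXn2r _ 2) ?nnegrE ?mulr_ge0 ?sqrtr_ge0 ?exprn_ge0
    ?(ltW th_gt0) ?(ltW (psi_gt0 i)) //.
  rewrite !exprMn sqr_sqrtr // real_normK ?num_real // (le_trans dom) //.
  rewrite mulr_sumr; apply: ler_sum => j ji.
  rewrite [leRHS]mulrCA ler_wpM2l ?sqr_ge0 // -exprMn mulrC.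
  rewrite -real_normK ?num_real // lerXn2r ?nnegrE //.
    exact: le_trans (IHp j (leq_trans ji le_ip) v).
  exact: IHp (leq_trans ji le_ip) v.
have {}gv_le : `|g v i 0| <= theta lam ^+ v * Num.sqrt S / psi (lam 0 i).
  by rewrite ler_pdivlMr // mulrC.
have tau_ge0 : 0 <= tau i.
  by apply: le_trans tau_ge; rewrite exprn_ge0 // sigma_ge0.
have := growth i v (k.+1 - v)%N; rewrite subnKC; last exact: leqW.
move=> /le_trans; apply.
(* As [theta < 1], replacing [v] by the earliest time [k.+1 - N] of the window gives a bound
   independent of [v]. *)
apply: (@le_trans _ _ (tau i * (theta lam ^+ (k.+1 - N) * Num.sqrt S / psi (lam 0 i)))).
  rewrite ler_pM // ?exprn_ge0 ?sigma_ge0 // (le_trans gv_le) //.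
  rewrite ler_pM2r ?invr_gt0 // ler_wpM2r ?sqrtr_ge0 //.
  by rewrite ler_wiXn2l // ltW.
have -> : tau i * (theta lam ^+ (k.+1 - N) * Num.sqrt S / psi (lam 0 i)) =
    tau i / (theta lam ^+ N * psi (lam 0 i)) * Num.sqrt S * theta lam ^+ k.+1.
  rewrite -[in RHS](subnK leNk) exprD; field.
  by rewrite expf_neq0 ?gt_eqF.
by rewrite ler_wpM2r ?exprn_ge0 ?(ltW th_gt0) // Ci le_max lexx orbT.
Qed.

(** * Convergence of the norm and the two cases *)

Lemma component_decay_R_linear (R : realType) (n : nat) (lam : 'rV[R]_n.+1)
    (g : nat -> 'cV[R]_n.+1) (C : 'I_n.+1 -> R) :
  0 < theta lam < 1 ->
  (forall i k, `|g k i 0| <= C i * theta lam ^+ k) -> R_linear_with lam g C.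
Proof.
move=> /andP[th_gt0 th_lt1] decay; split=> //.
pose B := Num.sqrt (\sum_i C i ^+ 2).
apply: (@squeeze_cvgr _ _ _ _ (fun=> 0) (fun k => B * theta lam ^+ k)).
- apply: nearW => k; rewrite sqrtr_ge0 /=.
  have th_ge0 : 0 <= theta lam ^+ k by rewrite exprn_ge0 // ltW.
  rewrite -[in leRHS](ger0_norm th_ge0) -sqrtr_sqr -sqrtrM.
    rewrite ler_wsqrtr // mulr_suml ler_sum // => i _.
    rewrite -exprMn -real_normK ?num_real // lerXn2r ?nnegrE //.
    exact: le_trans (decay i k).
  by apply: sumr_ge0 => i _; exact: sqr_ge0.
- exact: cvg_cst.
- rewrite -[X in (_ --> X)%classic](mulr0 B); apply: cvgM; first exact: cvg_cst.
  by apply: cvg_expr; rewrite ger0_norm ?ltW.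
Qed.

Lemma stop_or_R_linear (R : realType) (n : nat) (lam : 'rV[R]_n.+1)
    (b : 'cV[R]_n.+1) (x : nat -> 'cV[R]_n.+1) (alpha : nat -> R)
    (g : nat -> 'cV[R]_n.+1)
    (lam_gt0 : 0 < lam 0 ord0)
    (lam_incr : forall i j : 'I_n.+1, (i < j)%N -> lam 0 i < lam 0 j)
    (gE : forall k, g k = gradient (quadratic (diag_mx lam) b) (x k))
    (xS : forall k, x k.+1 = x k - alpha k *: g k)
    (alpha_bounds : stepsize_bounds lam g alpha (lam 0 ord_max))
    (psi : R -> R) (N : nat) (tau : 'I_n.+1 -> R) :
  (0 < N)%N -> laurent_admissible (lam 0 ord0) (lam 0 ord_max) psi ->
  (forall k i, g k != 0 -> (N <= k.+1)%N -> exists v : nat,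
    [/\ (k.+1 - N <= v <= k)%N, alpha k <= psi_quotient lam psi (g v) &
        sigma lam i ^+ (k.+1 - v) <= tau i]) ->
  (exists k, g k = 0) \/
  (exists C, rate_constants lam g psi N tau C /\ R_linear_with lam g C).
Proof.
move=> N_gt0 [_ [d dP]] window.
have [g0|g_neq0] := pselect (exists k, g k = 0); [by left|right].
have {}g_neq0 k : g k != 0 by apply/eqP => gk; apply: g_neq0; exists k.
have n_gt0 : (0 < n)%N.
  (* In dimension 1 the bounds force the exact step [alpha = 1 / lam]. *)
  rewrite lt0n; apply/negP => /eqP n0; subst n.
  case/eqP: (g_neq0 1%N); apply/colP => i.
  have := alpha_bounds 0%N (g_neq0 0%N).
  rewrite (gradient_step gE xS) mxE (ord1 i) (ord1 ord_max) -eq_le => /eqP ->.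
  have : (alpha 0%N)^-1 != 0.
    have /andP[+ _] := alpha_bounds 0%N (g_neq0 0%N).
    by move=> /(lt_le_trans lam_gt0); exact: lt0r_neq0.
  by rewrite invr_eq0 => a_neq0; rewrite divff // subrr mul0r.
have th := theta_itv lam_gt0 lam_incr n_gt0.
have psi_gt0 j : 0 < psi (lam 0 j).
  by have [] := dP _ (eigenvalue_bounds lam_incr j).
have [C CP] := rate_constants_exist lam g psi N tau.
exists C; split=> //; apply: component_decay_R_linear => //.
apply: component_decay CP => // k i; exact: window.
Qed.

Theorem theorem2 (R : realType) (n : nat) (lam : 'rV[R]_n.+1) (b : 'cV[R]_n.+1)
    (x : nat -> 'cV[R]_n.+1) (alpha : nat -> R) (g : nat -> 'cV[R]_n.+1)
    (lam_gt0 : 0 < lam 0 ord0)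
    (lam_incr : forall i j : 'I_n.+1, (i < j)%N -> lam 0 i < lam 0 j)
    (gE : forall k, g k = gradient (quadratic (diag_mx lam) b) (x k))
    (xS : forall k, x k.+1 = x k - alpha k *: g k)
    (alpha_bounds : stepsize_bounds lam g alpha (lam 0 ord_max)) :
  (forall (m r : nat) (psi : R -> R),
     (1 <= r <= m - 1)%N ->
     propertyB_lag lam g alpha psi r ->
     (exists k, g k = 0) \/
     (exists C : 'I_n.+1 -> R,
        rate_constants lam g psi r.+1 (fun i => sigma lam i ^+ r.+1) C /\
        R_linear_with lam g C))
  /\
  (forall (s : nat) (m_ : 'I_s -> nat) (psi : R -> R),
     (0 < s)%N -> (forall i, (0 < m_ i)%N) ->
     propertyB_multi lam g alpha psi m_ ->
     (exists k, g k = 0) \/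
     (exists C : 'I_n.+1 -> R,
        rate_constants lam g psi (\max_(i < s) m_ i)%N
          (fun i => Num.max (sigma lam i) (sigma lam i ^+ (\max_(j < s) m_ j)%N)) C /\
        R_linear_with lam g C)).
Proof.
split=> [m r psi _ [_ psiP lag]|s m_ psi s_gt0 m_gt0 [_ psiP multi]];
  apply: (stop_or_R_linear lam_gt0 lam_incr gE xS alpha_bounds) => //.
(* With [N = r.+1] the witness is the earliest time of the window, exactly [r.+1] steps before
   [k.+1]. *)
- move=> k i gk rk; exists (k - r)%N; split; first by rewrite subSS leqnn leq_subr.
    exact: lag.
  by have -> : (k.+1 - (k - r) = r.+1)%N by lia.
- exact: leq_trans (leq_bigmax (Ordinal s_gt0)).
- move=> k i gk leMk; set M := (\max_(_ < _) _)%N in leMk *.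
  have [v [/andP[v_ge v_le] a_le]] := multi k gk (Ordinal s_gt0).
  have vM : (k.+1 - M <= v)%N.
    by apply: leq_trans v_ge; rewrite leq_sub2l // leq_bigmax.
  exists v; split=> //; first by rewrite vM.
  have sg_ge0 := sigma_ge0 lam_gt0 lam_incr i.
  have [e_gt0 e_le] : (1 <= k.+1 - v)%N /\ (k.+1 - v <= M)%N by lia.
  (* The exponent lies between 1 and [M], and powers of [sigma] are monotone in the exponent, so an
     endpoint dominates: 1 if [sigma <= 1], [M] otherwise. *)
  rewrite le_max; have [le1|gt1] := leP (sigma lam i) 1.
    by rewrite -[X in _ <= X]expr1 ler_wiXn2l.
  by rewrite ler_weXn2l ?orbT // ltW.
Qed.
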